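(* Let $(M,\langle\cdot,\cdot\rangle)$ be a Riemannian manifold of dimension at least $3$, and let $E$ be a Killing vector field of constant length on $M$. If at every point of $M$ the sectional curvatures of all tangent planes containing $E$ are non-positive, then all these sectional curvatures are equal to zero and $\nabla_XE=0$ for every vector field $X$.
   Context: $\nabla$ is the Levi-Civita connection. $E$ is a Killing field if $\langle\nabla_XE,Y\rangle+\langle\nabla_YE,X\rangle=0$ for all vector fields $X,Y$.
   Formalization: The constant length of E is assumed to be nonzero: for E = 0 every tangent plane contains E and the claim fails, for example on hyperbolic 3-space. *)

(* Defs.v *)
From HB Require Import structures.
From mathcomp Require Import all_boot all_order all_algebra.
From mathcomp Require Import ring.
From mathcomp Require Import all_classical all_reals all_analysis.

Set Implicit Arguments.
Unset Strict Implicit.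
Unset Printing Implicit Defensive.
Import Order.TTheory GRing.Theory Num.Theory.
Import numFieldNormedType.Exports.
Local Open Scope classical_set_scope.
Local Open Scope ring_scope.

Section Smoothness.
Variables (R : realType) (n : nat).
Implicit Types (U : set 'rV[R]_n) (f g : 'rV[R]_n -> R).

(* Meant for open U: derivatives are two-sided and may use values off U. *)
Fixpoint Ck (k : nat) U f : Prop :=
  (forall x, U x -> {for x, continuous f}) /\
  if k is k'.+1 then
    forall i : 'I_n, (forall x, U x -> derivable f x 'e_i) /\
                     Ck k' U (fun x => 'D_('e_i) f x)
  else True.

Definition Cinfty U f : Prop := forall k, Ck k U f.

Lemma CkW k U f : Ck k.+1 U f -> Ck k U f.
Proof.
elim: k f => [|k IH] f [fc fd]; first by split.
by split=> // i; have [? /IH] := fd i.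
Qed.

Lemma eq_Ck k U f g : open U -> (forall x, U x -> f x = g x) ->
  Ck k U f -> Ck k U g.
Proof.
move=> oU.
have nearU x (h h' : 'rV[R]_n -> R) : (forall x, U x -> h x = h' x) ->
    U x -> \forall y \near x, h y = h' y.
  by move=> hh' Ux; near do apply: hh'; exact: open_nbhs_nbhs.
have eqC (h h' : 'rV[R]_n -> R) : (forall x, U x -> h x = h' x) ->
    (forall x, U x -> {for x, continuous h}) ->
    forall x, U x -> {for x, continuous h'}.
  move=> hh' hc x Ux; rewrite /prop_for /continuous_at -(hh' x Ux).
  have := hc x Ux; rewrite /prop_for /continuous_at; apply: cvg_trans.
  by apply: (@near_eq_cvg _ _ (nbhs x)); exact: nearU.
elim: k f g => [|k IH] f g fg [fc fd]; split; try exact: eqC fc.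
  by [].
move=> i; have [fdi fki] := fd i; split.
  by move=> x Ux; apply: near_eq_derivable (fdi _ Ux); exact: nearU.
by apply: IH fki => x Ux; apply: near_eq_derive; exact: nearU.
Unshelve. all: by end_near. Qed.

Lemma Ck_cst k U (a : R) : open U -> Ck k U (cst a).
Proof.
move=> oU; elim: k a => [|k IH] a; split=> //.
- by move=> x _; exact: cst_continuous.
- by move=> x _; exact: cst_continuous.
- move=> i; split=> [x _|]; first exact: derivable_cst.
  by apply: eq_Ck (IH 0) => // x _; rewrite derive_cst.
Qed.

Lemma CkD k U f g : open U -> Ck k U f -> Ck k U g -> Ck k U (f \+ g).
Proof.
move=> oU; elim: k f g => [|k IH] f g [fc fd] [gc gd]; split=> //.
- by move=> x Ux; apply: continuousD; [exact: fc|exact: gc].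
- by move=> x Ux; apply: continuousD; [exact: fc|exact: gc].
- move=> i; have [fdi fki] := fd i; have [gdi gki] := gd i; split.
    by move=> x Ux; apply: derivableD; [exact: fdi|exact: gdi].
  apply: eq_Ck (IH _ _ fki gki) => // x Ux /=.
  by rewrite -deriveD //; [exact: fdi|exact: gdi].
Qed.

Lemma CkM k U f g : open U -> Ck k U f -> Ck k U g -> Ck k U (f \* g).
Proof.
move=> oU; elim: k f g => [|k IH] f g fk gk; split.
- by move=> x Ux; apply: continuousM; [exact: fk.1|exact: gk.1].
- by [].
- by move=> x Ux; apply: continuousM; [exact: fk.1|exact: gk.1].
- move=> i; have [fdi fki] := fk.2 i; have [gdi gki] := gk.2 i; split.
    by move=> x Ux; apply: derivableM; [exact: fdi|exact: gdi].
  apply: eq_Ck (CkD oU (IH _ _ (CkW fk) gki) (IH _ _ (CkW gk) fki)) => // x Ux.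
  by rewrite [RHS]deriveM //; [exact: fdi|exact: gdi].
Qed.

End Smoothness.

(* A homeomorphism from an open set of M onto an open set of R^n; the total
   functions are only meaningful on chart_dom and on its image. *)
Record chart (R : realType) (n : nat) (M : topologicalType) := Chart {
  chart_dom : set M;
  chart_map : M -> 'rV[R]_n;
  chart_inv : 'rV[R]_n -> M;
  chart_dom_open : open chart_dom;
  chart_img_open : open (chart_map @` chart_dom);
  chart_mapK : {in chart_dom, cancel chart_map chart_inv};
  chart_map_continuous :
    forall x, chart_dom x -> {for x, continuous chart_map};
  chart_inv_continuous :
    forall y, (chart_map @` chart_dom) y -> {for y, continuous chart_inv}
}.

Definition chart_compatible (R : realType) (n : nat) (M : topologicalType)
    (c d : chart R n M) : Prop :=
  forall i : 'I_n,
    Cinfty (chart_map c @` (chart_dom c `&` chart_dom d))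
           (fun y => chart_map d (chart_inv c y) ord0 i).

(* The atlas need not be maximal. *)
Record manifold (R : realType) (n : nat) := Manifold {
  manifold_space :> topologicalType;
  atlas : set (chart R n manifold_space);
  manifold_hausdorff : hausdorff_space manifold_space;
  manifold_second_countable : @second_countable manifold_space;
  atlas_cover : forall x : manifold_space,
    exists2 c, atlas c & chart_dom c x;
  atlas_compatible : forall c d, atlas c -> atlas d -> chart_compatible c d
}.

Section SmoothFunctions.
Variables (R : realType) (n : nat) (M : manifold R n).

Definition smooth (f : M -> R) : Prop :=
  forall c, @atlas R n M c ->
    Cinfty (chart_map c @` chart_dom c) (f \o chart_inv c).

Definition smoothp : {pred M -> R} := fun f => `[< smooth f >].

Fact smooth_cst (a : R) : smooth (cst a).
Proof. by move=> c _ k; apply: Ck_cst; exact: chart_img_open. Qed.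

Fact smoothD f g : smooth f -> smooth g -> smooth (f \+ g).
Proof.
by move=> fs gs c ac k; apply: CkD;
  [exact: chart_img_open|exact: fs|exact: gs].
Qed.

Fact smoothM f g : smooth f -> smooth g -> smooth (f \* g).
Proof.
by move=> fs gs c ac k; apply: CkM;
  [exact: chart_img_open|exact: fs|exact: gs].
Qed.

Fact smoothp_submod : submod_closed smoothp.
Proof.
split; first by apply/asboolP; exact: smooth_cst.
move=> a f g /asboolP fs /asboolP gs; apply/asboolP.
by apply: smoothD => //; apply: smoothM => //; exact: smooth_cst.
Qed.

Fact smoothp_subring : subring_closed smoothp.
Proof.
split; first by apply/asboolP; exact: smooth_cst.
- move=> f g fs gs; rewrite -scaleN1r addrC.
  exact: (smoothp_submod.2).
- move=> f g /asboolP fs /asboolP gs; apply/asboolP; exact: smoothM.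
Qed.

HB.instance Definition _ :=
  GRing.isSubringClosed.Build (M -> R) smoothp smoothp_subring.
HB.instance Definition _ :=
  GRing.isSubmodClosed.Build R (M -> R) smoothp smoothp_submod.

Record smoothfun := SmoothFun {
  smoothfun_val :> M -> R;
  smoothfun_in : smoothfun_val \in smoothp
}.

HB.instance Definition _ := [isSub for smoothfun_val].
HB.instance Definition _ := [Choice of smoothfun by <:].
HB.instance Definition _ := 
  GRing.SubChoice_isSubComPzRing.Build _ _ smoothfun smoothp_subring.
HB.instance Definition _ := [SubZmodule_isSubLmodule of smoothfun by <:].

Definition mk_smoothfun (f : M -> R) (fs : smooth f) : smoothfun :=
  SmoothFun (asboolT fs).

End SmoothFunctions.

Section TangentSpace.
Variables (R : realType) (n : nat) (M : manifold R n) (p : M).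

(* Tangent vectors at p are the derivations at p of the algebra of smooth
   functions on M. *)
Definition derivation_at : {pred smoothfun M -> R} := fun v => `[<
  (forall (a : R) f h, v (a *: f + h) = a * v f + v h) /\
  (forall f h, v (f * h) = f p * v h + v f * h p) >].

Fact derivation_at_submod : submod_closed derivation_at.
Proof.
split; first by apply/asboolP; split=> *; rewrite /= ?(mulr0,mul0r,addr0).
move=> a u v /asboolP[ul uL] /asboolP[vl vL]; apply/asboolP.
have uvE f : (a *: u + v) f = a * u f + v f by [].
by split=> [b f h|f h]; rewrite !uvE ?ul ?vl ?uL ?vL; ring.
Qed.

HB.instance Definition _ :=
  GRing.isSubmodClosed.Build R (smoothfun M -> R) derivation_at
    derivation_at_submod.

Record tangent := Tangent {
  tangent_val :> smoothfun M -> R;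
  tangent_in : tangent_val \in derivation_at
}.

HB.instance Definition _ := [isSub for tangent_val].
HB.instance Definition _ := [Choice of tangent by <:].
HB.instance Definition _ := [SubChoice_isSubLmodule of tangent by <:].

End TangentSpace.

Section VectorFields.
Variables (R : realType) (n : nat) (M : manifold R n).
Local Notation T := (@tangent R n M).

Definition smooth_section (X : forall p, T p) : Prop :=
  forall f : smoothfun M, smooth (fun p => X p f).

Record vfield := VField {
  vfield_val :> forall p : M, T p;
  vfield_smooth : smooth_section vfield_val
}.

HB.instance Definition _ := gen_eqMixin vfield.
HB.instance Definition _ := gen_choiceMixin vfield.

Lemma vfieldP (X Y : vfield) : (forall p, X p = Y p) -> X = Y.
Proof.
case: X Y => [X sX] [Y sY] /= XY.
have {}XY : X = Y by exact: functional_extensionality_dep.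
by subst Y; congr VField; exact: Prop_irrelevance.
Qed.

Lemma smoothfunS (f : smoothfun M) : smooth f.
Proof. exact/asboolP/smoothfun_in. Qed.

Fact smooth_section0 : smooth_section (fun p => 0).
Proof. by move=> f; exact: smooth_cst. Qed.

Fact smooth_sectionD (X Y : vfield) : smooth_section (fun p => X p + Y p).
Proof. by move=> f; apply: smoothD; exact: vfield_smooth. Qed.

Fact smooth_sectionZ (h : smoothfun M) (X : vfield) :
  smooth_section (fun p => h p *: X p).
Proof.
by move=> f; apply: smoothM; [exact: smoothfunS|exact: vfield_smooth].
Qed.

Definition vfield0 : vfield := VField smooth_section0.
Definition vfield_add (X Y : vfield) : vfield := VField (smooth_sectionD X Y).
Definition vfield_scale (h : smoothfun M) (X : vfield) : vfield :=
  VField (smooth_sectionZ h X).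
Definition vfield_opp (X : vfield) : vfield := vfield_scale (-1) X.

Fact vfield_addA : associative vfield_add.
Proof. by move=> X Y Z; apply: vfieldP => p /=; rewrite addrA. Qed.
Fact vfield_addC : commutative vfield_add.
Proof. by move=> X Y; apply: vfieldP => p /=; rewrite addrC. Qed.
Fact vfield_add0 : left_id vfield0 vfield_add.
Proof. by move=> X; apply: vfieldP => p /=; rewrite add0r. Qed.
Fact vfield_addN : left_inverse vfield0 vfield_opp vfield_add.
Proof. by move=> X; apply: vfieldP => p /=; rewrite scaleN1r addNr. Qed.

HB.instance Definition _ := GRing.isZmodule.Build vfield
  vfield_addA vfield_addC vfield_add0 vfield_addN.

Fact vfield_scaleA (a b : smoothfun M) (X : vfield) :
  vfield_scale a (vfield_scale b X) = vfield_scale (a * b) X.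
Proof. by apply: vfieldP => p /=; rewrite scalerA. Qed.
Fact vfield_scale1 : left_id 1 vfield_scale.
Proof. by move=> X; apply: vfieldP => p /=; rewrite scale1r. Qed.
Fact vfield_scaleDr : right_distributive vfield_scale +%R.
Proof. by move=> a X Y; apply: vfieldP => p /=; rewrite scalerDr. Qed.
Fact vfield_scaleDl (X : vfield) :
  {morph vfield_scale^~ X : a b / a + b}.
Proof. by move=> a b; apply: vfieldP => p /=; rewrite scalerDl. Qed.

HB.instance Definition _ := GRing.Zmodule_isLmodule.Build (smoothfun M) vfield
  vfield_scaleA vfield_scale1 vfield_scaleDr vfield_scaleDl.

Definition lie_derive (X : vfield) (f : smoothfun M) : smoothfun M :=
  mk_smoothfun (vfield_smooth X f).

Lemma tangentP p (v : T p) :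
  (forall (a : R) f h, v (a *: f + h) = a * v f + v h) /\
  (forall f h, v (f * h) = f p * v h + v f * h p).
Proof. exact/asboolP/tangent_in. Qed.

Definition bracket_at (X Y : vfield) (p : M) (f : smoothfun M) : R :=
  X p (lie_derive Y f) - Y p (lie_derive X f).

Lemma lie_deriveL (X : vfield) (a : R) f h :
  lie_derive X (a *: f + h) = a *: lie_derive X f + lie_derive X h.
Proof. by apply/val_inj/funext => p /=; rewrite (tangentP (X p)).1. Qed.

Lemma lie_deriveM (X : vfield) f h :
  lie_derive X (f * h) = f * lie_derive X h + lie_derive X f * h.
Proof. by apply/val_inj/funext => p /=; rewrite (tangentP (X p)).2. Qed.

Lemma tangentD p (v : T p) f h : v (f + h) = v f + v h.
Proof. by have := (tangentP v).1 1 f h; rewrite scale1r mul1r. Qed.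

Fact bracket_at_derivation X Y p : bracket_at X Y p \in derivation_at p.
Proof.
apply/asboolP; split=> [a f h|f h]; rewrite /bracket_at.
  by rewrite !lie_deriveL !(tangentP _).1; ring.
by rewrite !lie_deriveM !tangentD !(tangentP _).2 /=; ring.
Qed.

Fact bracket_smooth X Y :
  smooth_section (fun p => Tangent (bracket_at_derivation X Y p)).
Proof.
move=> f.
have -> : (fun p => bracket_at X Y p f) =
          val (lie_derive X (lie_derive Y f) - lie_derive Y (lie_derive X f)).
  by apply/funext => p.
exact: smoothfunS.
Qed.

Definition bracket (X Y : vfield) : vfield := VField (bracket_smooth X Y).

End VectorFields.

Section RiemannianGeometry.
Variables (R : realType) (n : nat) (M : manifold R n).
Local Notation T := (@tangent R n M).
Local Notation VF := (vfield M).

Record riemannian_metric := RiemannianMetric {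
  metric : forall p : M, T p -> T p -> R;
  metric_sym : forall p (u v : T p), metric u v = metric v u;
  metric_linear : forall p (a : R) (u v w : T p),
    metric (a *: u + v) w = a * metric u w + metric v w;
  metric_pos : forall p (u : T p), u != 0 -> 0 < metric u u;
  metric_smooth : forall X Y : VF, smooth (fun p => metric (X p) (Y p))
}.

Variable g : riemannian_metric.

Definition inner (X Y : VF) : smoothfun M := mk_smoothfun (metric_smooth g X Y).

(* D X Y is the covariant derivative of Y in the direction X. *)
Variable D : VF -> VF -> VF.

Record affine_connection : Prop := AffineConnection {
  connection_linear : forall (f : smoothfun M) X Y Z,
    D (f *: X + Y) Z = f *: D X Z + D Y Z;
  connection_additive : forall X Y Z, D X (Y + Z) = D X Y + D X Z;
  connection_leibniz : forall (f : smoothfun M) X Y,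
    D X (f *: Y) = lie_derive X f *: Y + f *: D X Y
}.

Record levi_civita : Prop := LeviCivita {
  levi_civita_connection : affine_connection;
  levi_civita_torsion_free : forall X Y, D X Y - D Y X = bracket X Y;
  levi_civita_metric : forall X Y Z,
    lie_derive X (inner Y Z) = inner (D X Y) Z + inner Y (D X Z)
}.

Definition killing (E : VF) : Prop :=
  forall X Y, inner (D X E) Y + inner (D Y E) X = 0.

Definition curvature (X Y Z : VF) : VF :=
  D X (D Y Z) - D Y (D X Z) - D (bracket X Y) Z.

Definition lin_indep p (u v : T p) : Prop :=
  forall a b : R, a *: u + b *: v = 0 -> a = 0 /\ b = 0.

Definition span2 p (u v : T p) : set (T p) :=
  [set w | exists a b : R, w = a *: u + b *: v].

Definition tangent_plane p (s : set (T p)) : Prop :=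
  exists u v : T p, lin_indep u v /\ s = span2 u v.

(* The value depends neither on the basis of the plane s nor on its extension
   to vector fields, and every basis extends; the default 0 of xget is taken
   only when s is not a plane. *)
Definition sectional_curvature p (s : set (T p)) : R :=
  xget 0 [set k : R | exists X Y : VF,
    [/\ lin_indep (X p) (Y p), s = span2 (X p) (Y p) &
        k = inner (curvature X Y Y) X p /
            (inner X X p * inner Y Y p - inner X Y p ^+ 2)]].

Definition field_length (X : VF) (p : M) : R := Num.sqrt (metric g (X p) (X p)).

End RiemannianGeometry.

(* Main.v *)
Require Import Defs.
From mathcomp Require Import all_boot all_order all_algebra.
From mathcomp Require Import ring lra.
From mathcomp Require Import all_classical all_reals all_analysis.
Import Order.TTheory GRing.Theory Num.Theory.
Local Open Scope classical_set_scope.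
Local Open Scope ring_scope.

(** The curvature identity behind the result is that a Killing field E of
constant length satisfies <R(X,E)E,X> = |nabla_X E|^2 (killing_curv4).  Constant
length makes nabla_X E orthogonal to E (const_length_orth), and then the Killing
equation gives nabla_E E = 0 (killing_geodesic), which removes one of the three
terms of R(X,E)E; the other two are evaluated by differentiating
<nabla_X E, X> = 0 along E.  So a plane containing E has curvature at least 0,
and the hypothesis forces nabla_X E = 0 whenever X and E are independent at the
point.  When they are dependent, X is a multiple of E at the point, and
|nabla_X E|^2 = - <nabla_{nabla_X E} E, X> is a multiple of the zero number
<nabla_{nabla_X E} E, E>.  Once E is parallel, R(.,.)E = 0, and a plane
containing E is flat.

To use the sign hypothesis one needs that the sectional curvature of a plane can
be computed from any pair of fields spanning it (sectional_curvatureE), that is,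
that R(X,Y,Z,W) = <R(X,Y)Z,W> at p depends only on the values at p of its four
arguments.  The symmetries of the curvature tensor take the place of the usual
localisation by bump functions: the dependence on W is pointwise by
construction, and curv4_skew12, curv4_skew34 and curv4_pair carry each of the
other arguments to the place of W. *)

(** * Vector fields as derivations *)

Section VectorFields.
Set Implicit Arguments.
Unset Strict Implicit.
Variables (R : realType) (n : nat) (M : manifold R n).
Implicit Types (X Y Z : vfield M) (f h : smoothfun M) (p : M).

Lemma vfield_ext X Y : (forall p f, X p f = Y p f) -> X = Y.
Proof.
move=> XY; apply: vfieldP => p; apply: val_inj.
by apply/funext => f; apply: XY.
Qed.

Lemma tangentB p (v : tangent p) f h : v (f - h) = v f - v h.
Proof.
have := (tangentP v).1 (-1) h f.
by rewrite scaleN1r mulN1r addrC => ->; rewrite addrC.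
Qed.

(** A derivation kills 1 because 1 = 1 * 1, hence kills all constants. *)
Lemma tangent_cst p (v : tangent p) f c : (forall q, f q = c) -> v f = 0.
Proof.
move=> fc; have -> : f = c *: (1 : smoothfun M) + 0.
  rewrite addr0; apply: val_inj; apply/funext => q.
  by rewrite /= fc; apply/esym/mulr1.
have v1 : v 1 = 0.
  apply: (addrI (v 1)); rewrite addr0.
  have := (tangentP v).2 1 1; rewrite mulr1 => {3}->.
  by congr (_ + _); [exact/esym/mul1r|exact/esym/mulr1].
have v0 : v 0 = 0 by apply: (addrI (v 0)); rewrite -tangentD !addr0.
by rewrite (tangentP v).1 v1 v0 mulr0 addr0.
Qed.

Lemma vfieldDE X Y p : (X + Y) p = X p + Y p. Proof. by []. Qed.
Lemma vfieldNE X p : (- X) p = - X p. Proof. by rewrite -[RHS]scaleN1r. Qed.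
Lemma vfieldBE X Y p : (X - Y) p = X p - Y p.
Proof. by rewrite vfieldDE vfieldNE. Qed.

Lemma bracketE X Y p f :
  bracket X Y p f = X p (lie_derive Y f) - Y p (lie_derive X f).
Proof. by []. Qed.

Lemma bracketC X Y : bracket X Y = - bracket Y X.
Proof.
apply: vfield_ext => p f; rewrite vfieldNE.
by change (bracket X Y p f = - bracket Y X p f); rewrite !bracketE opprB.
Qed.

Lemma lie_derive_bracket X Y f : lie_derive (bracket X Y) f =
  lie_derive X (lie_derive Y f) - lie_derive Y (lie_derive X f).
Proof. by apply: val_inj; apply/funext. Qed.

Lemma jacobi X Y Z :
  bracket X (bracket Y Z) + bracket Y (bracket Z X) + bracket Z (bracket X Y)
  = 0.
Proof.
apply: vfield_ext => p f.
change (bracket X (bracket Y Z) p f + bracket Y (bracket Z X) p f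
  + bracket Z (bracket X Y) p f = 0).
by rewrite !bracketE !lie_derive_bracket !tangentB; ring.
Qed.

End VectorFields.

(** * Inner products and Gram determinants *)

Section Metric.
Set Implicit Arguments.
Unset Strict Implicit.
Variables (R : realType) (n : nat) (M : manifold R n).
Variable g : riemannian_metric M.
Variable p : M.
Implicit Types u v w : tangent p.

Lemma metricDl u v w : metric g (u + v) w = metric g u w + metric g v w.
Proof. by have := metric_linear g 1 u v w; rewrite scale1r mul1r. Qed.

Lemma metric0l w : metric g 0 w = 0.
Proof. by apply: (addrI (metric g 0 w)); rewrite -metricDl !addr0. Qed.

Lemma metricZl a u w : metric g (a *: u) w = a * metric g u w.
Proof. by have := metric_linear g a u 0 w; rewrite metric0l !addr0. Qed.

Lemma metricNl u w : metric g (- u) w = - metric g u w.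
Proof. by rewrite -scaleN1r metricZl mulN1r. Qed.

Lemma metricBl u v w : metric g (u - v) w = metric g u w - metric g v w.
Proof. by rewrite metricDl metricNl. Qed.

Lemma metricDr u v w : metric g w (u + v) = metric g w u + metric g w v.
Proof. by rewrite !(Defs.metric_sym g w) metricDl. Qed.

Lemma metricZr a u w : metric g w (a *: u) = a * metric g w u.
Proof. by rewrite !(Defs.metric_sym g w) metricZl. Qed.

Lemma metricBr u v w : metric g w (u - v) = metric g w u - metric g w v.
Proof. by rewrite !(Defs.metric_sym g w) metricBl. Qed.

Lemma metric_ge0 u : 0 <= metric g u u.
Proof. by have [->|/(metric_pos g)/ltW//] := eqVneq u 0; rewrite metric0l. Qed.

Lemma metric_eq0 u : metric g u u = 0 -> u = 0.
Proof.
move=> u0; apply/eqP; apply/negPn/negP => /(metric_pos g).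
by rewrite u0 ltxx.
Qed.

(** The squared area of the parallelogram spanned by u and v. *)
Definition gram u v := metric g u u * metric g v v - metric g u v ^+ 2.

(** The strict Cauchy-Schwarz inequality: w = <v,v> u - <u,v> v is nonzero and
<w,w> = <v,v> * gram u v. *)
Lemma gram_gt0 u v : lin_indep u v -> 0 < gram u v.
Proof.
move=> li.
have v0 : v != 0.
  apply/eqP => v0; have [] := li 0 1.
    by rewrite v0 scaler0 scale0r addr0.
  by move=> _ /eqP; rewrite oner_eq0.
have vv : 0 < metric g v v by exact: metric_pos.
have w0 : metric g v v *: u - metric g u v *: v != 0.
  apply/eqP => w0; have [] := li (metric g v v) (- metric g u v).
    by rewrite scaleNr.
  by move=> vv0 _; rewrite vv0 ltxx in vv.
have := metric_pos g w0.
rewrite [ltRHS](_ : _ = metric g v v * gram u v) ?pmulr_rgt0 //.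
rewrite /gram !(metricBl, metricBr, metricZl, metricZr) (Defs.metric_sym g v u).
by ring.
Qed.

Lemma gram_comb u v a b a' b' :
  gram (a *: u + b *: v) (a' *: u + b' *: v) =
  (a * b' - b * a') ^+ 2 * gram u v.
Proof.
rewrite /gram !(metricDl, metricDr, metricZl, metricZr) (Defs.metric_sym g v u).
by ring.
Qed.

End Metric.

(** * Symmetries of the curvature tensor *)

Section Curvature.
Set Implicit Arguments.
Unset Strict Implicit.
Variables (R : realType) (n : nat) (M : manifold R n).
Variables (g : riemannian_metric M) (D : vfield M -> vfield M -> vfield M).
Hypothesis lcD : levi_civita g D.
Implicit Types (X Y Z W E : vfield M) (p : M).
Let conD := levi_civita_connection lcD.

Lemma connDl X Y Z : D (X + Y) Z = D X Z + D Y Z.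
Proof. by have := connection_linear conD 1 X Y Z; rewrite !scale1r. Qed.

Lemma conn0l Z : D 0 Z = 0.
Proof. by apply: (addrI (D 0 Z)); rewrite -connDl !addr0. Qed.

Lemma connNl X Z : D (- X) Z = - D X Z.
Proof. by apply: (addrI (D X Z)); rewrite -connDl !subrr conn0l. Qed.

Lemma connBl X Y Z : D (X - Y) Z = D X Z - D Y Z.
Proof. by rewrite connDl connNl. Qed.

Lemma conn0r X : D X 0 = 0.
Proof.
by apply: (addrI (D X 0)); rewrite -(connection_additive conD) !addr0.
Qed.

Lemma connNr X Y : D X (- Y) = - D X Y.
Proof.
by apply: (addrI (D X Y)); rewrite -(connection_additive conD) !subrr conn0r.
Qed.

Lemma connBr X Y Z : D X (Y - Z) = D X Y - D X Z.
Proof. by rewrite (connection_additive conD) connNr. Qed.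

Lemma metric_compat X Y Z p : X p (inner g Y Z) =
  metric g (D X Y p) (Z p) + metric g (Y p) (D X Z p).
Proof.
by have /(congr1 (fun f : smoothfun M => f p)) := levi_civita_metric lcD X Y Z.
Qed.

(** Antisymmetrised in X and Y, the mixed terms cancel: this is what makes the
curvature skew-adjoint. *)
Lemma metric_compat2 X Y Z W p : X p (lie_derive Y (inner g Z W)) =
  metric g (D X (D Y Z) p) (W p) + metric g (D Y Z p) (D X W p) +
  (metric g (D X Z p) (D Y W p) + metric g (Z p) (D X (D Y W) p)).
Proof. by rewrite (levi_civita_metric lcD) tangentD !metric_compat. Qed.

Definition curv4 X Y Z W p := metric g (curvature D X Y Z p) (W p).

Lemma curv4E X Y Z W p : curv4 X Y Z W p =
  metric g (D X (D Y Z) p) (W p) - metric g (D Y (D X Z) p) (W p)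
  - metric g (D (bracket X Y) Z p) (W p).
Proof. by rewrite /curv4 /curvature !vfieldBE !metricBl. Qed.

Lemma curv4_skew12 X Y Z W p : curv4 X Y Z W p = - curv4 Y X Z W p.
Proof. by rewrite !curv4E (bracketC X Y) connNl vfieldNE metricNl; ring. Qed.

(** The second derivatives X (Y <Z,W>) - Y (X <Z,W>) equal [X,Y] <Z,W>; expanding
both sides by metric compatibility leaves this identity. *)
Lemma curv4_skew34 X Y Z W p : curv4 X Y Z W p = - curv4 X Y W Z p.
Proof.
have := metric_compat (bracket X Y) Z W p.
rewrite bracketE !metric_compat2 !curv4E.
rewrite !(Defs.metric_sym g (Z p)).
lra.
Qed.

(** The first Bianchi identity: absence of torsion reduces the cyclic sum to the
Jacobi identity. *)
Lemma bianchi X Y Z W p :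
  curv4 X Y Z W p + curv4 Y Z X W p + curv4 Z X Y W p = 0.
Proof.
have tf X' Y' Z' : metric g (D X' (D Y' Z') p) (W p) =
    metric g (D X' (D Z' Y') p) (W p) + metric g (D (bracket Y' Z') X' p) (W p)
    + metric g (bracket X' (bracket Y' Z') p) (W p).
  rewrite -(levi_civita_torsion_free lcD X') -(levi_civita_torsion_free lcD Y').
  by rewrite connBr !vfieldBE !metricBl; ring.
have := congr1 (fun V : vfield M => metric g (V p) (W p)) (jacobi X Y Z).
rewrite !vfieldDE !metricDl metric0l.
rewrite !curv4E (tf X Y Z) (tf Y Z X) (tf Z X Y).
lra.
Qed.

(** The usual octahedron argument: a combination of four instances of the Bianchi
identity in which, up to the two skew-symmetries, all other terms cancel. *)
Lemma curv4_pair X Y Z W p : curv4 X Y Z W p = curv4 Z W X Y p.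
Proof.
have := bianchi X Y Z W p; have := bianchi Y Z W X p.
have := bianchi Z W X Y p; have := bianchi W X Y Z p.
rewrite (curv4_skew34 Y Z W X) (curv4_skew34 Z W Y X) (curv4_skew34 X Y W Z).
rewrite (curv4_skew34 W X Z Y) (curv4_skew34 X Z W Y) (curv4_skew12 X Z Y W).
rewrite (curv4_skew12 Y W X Z) (curv4_skew34 W Y X Z).
lra.
Qed.

(** Tensoriality at p: the relation between the fields is only assumed at that
point.  In the last argument this holds because the metric is evaluated
pointwise; in the others, by moving them to the last place with the symmetries
(curv4_linear3, curv4_linear1, curv4_linear2). *)
Lemma curv4_linear4 X Y Z W W1 W2 p (a b : R) : W p = a *: W1 p + b *: W2 p ->
  curv4 X Y Z W p = a * curv4 X Y Z W1 p + b * curv4 X Y Z W2 p.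
Proof. by rewrite /curv4 => ->; rewrite metricDr !metricZr. Qed.

Lemma curv4_linear3 X Y Z W Z1 Z2 p (a b : R) : Z p = a *: Z1 p + b *: Z2 p ->
  curv4 X Y Z W p = a * curv4 X Y Z1 W p + b * curv4 X Y Z2 W p.
Proof.
move=> Zp; rewrite !(curv4_skew34 X Y _ W) (curv4_linear4 _ _ _ Zp).
by rewrite !mulrN opprD.
Qed.

Lemma curv4_linear1 X Y Z W X1 X2 p (a b : R) : X p = a *: X1 p + b *: X2 p ->
  curv4 X Y Z W p = a * curv4 X1 Y Z W p + b * curv4 X2 Y Z W p.
Proof. by move=> Xp; rewrite !(curv4_pair _ Y Z W) (curv4_linear3 _ _ _ Xp). Qed.

Lemma curv4_linear2 X Y Z W Y1 Y2 p (a b : R) : Y p = a *: Y1 p + b *: Y2 p ->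
  curv4 X Y Z W p = a * curv4 X Y1 Z W p + b * curv4 X Y2 Z W p.
Proof. by move=> Yp; rewrite !(curv4_pair X _ Z W) (curv4_linear4 _ _ _ Yp). Qed.

Lemma curv4_skew12_diag X Z W p : curv4 X X Z W p = 0.
Proof. by have := curv4_skew12 X X Z W p; lra. Qed.

Lemma curv4_skew34_diag X Y Z p : curv4 X Y Z Z p = 0.
Proof. by have := curv4_skew34 X Y Z Z p; lra. Qed.

(** * Sectional curvature is independent of the basis *)

Lemma curv4_basis_change X Y X' Y' p (a b a' b' : R) :
  X' p = a *: X p + b *: Y p -> Y' p = a' *: X p + b' *: Y p ->
  curv4 X' Y' Y' X' p = (a * b' - b * a') ^+ 2 * curv4 X Y Y X p.
Proof.
move=> X'p Y'p; rewrite (curv4_linear1 _ _ _ X'p) !(curv4_linear2 _ _ _ Y'p).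
rewrite !curv4_skew12_diag !(curv4_linear3 _ _ _ Y'p) !(curv4_linear4 _ _ _ X'p).
rewrite !curv4_skew34_diag.
rewrite (curv4_skew34 X Y X Y) (curv4_skew12 Y X Y X) (curv4_skew12 Y X X Y).
rewrite (curv4_skew34 X Y X Y).
by ring.
Qed.

(** Under a change of basis the numerator and the Gram determinant both get
multiplied by the square of the same determinant, which is nonzero because the
Gram determinant of the new pair is positive. *)
Lemma sectional_curvatureE X Y p : lin_indep (X p) (Y p) ->
  sectional_curvature g D (span2 (X p) (Y p)) =
  curv4 X Y Y X p / gram g (X p) (Y p).
Proof.
move=> li; apply: xget_unique; first by exists X, Y.
move=> _ [X' [Y' [li' sE ->]]].
rewrite -[LHS]/(curv4 X' Y' Y' X' p / gram g (X' p) (Y' p)).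
have [a [b X'p]] : span2 (X p) (Y p) (X' p).
  by rewrite sE; exists 1, 0; rewrite scale1r scale0r addr0.
have [a' [b' Y'p]] : span2 (X p) (Y p) (Y' p).
  by rewrite sE; exists 0, 1; rewrite scale1r scale0r add0r.
have := gram_gt0 g li'.
rewrite (curv4_basis_change X'p Y'p) X'p Y'p gram_comb.
set d := _ ^+ 2 => dgram; have d0 : d != 0.
  by apply: contraTneq dgram => ->; rewrite mul0r ltxx.
by rewrite -mulf_div divff // mul1r.
Qed.

(** * Killing fields of constant length *)

Lemma killing_skew E X Y p : killing g D E ->
  metric g (D X E p) (Y p) = - metric g (D Y E p) (X p).
Proof.
by move=> /(_ X Y) /(congr1 (fun f : smoothfun M => f p)) /eqP;
  rewrite addr_eq0 => /eqP.
Qed.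

(** Twice the left-hand side is the derivative of <E,E> along X. *)
Lemma const_length_orth E X p c :
  (forall q, metric g (E q) (E q) = c) -> metric g (D X E p) (E p) = 0.
Proof.
move=> Ec.
have := metric_compat X E E p; rewrite (@tangent_cst _ _ _ _ _ (inner g E E) c)
  //.
rewrite (Defs.metric_sym g (E p)); lra.
Qed.

(** The Killing equation turns |nabla_E E|^2 into - <nabla_{nabla_E E} E, E>, and
this vanishes by constancy of the length. *)
Lemma killing_geodesic E c : killing g D E ->
  (forall q, metric g (E q) (E q) = c) -> D E E = 0.
Proof.
move=> kE Ec; apply: vfieldP => p; apply: (@metric_eq0 _ _ _ g).
by rewrite killing_skew // (const_length_orth _ _ Ec) oppr0.
Qed.

(** Since nabla_E E = 0 and [X,E] = nabla_X E - nabla_E X, the left-hand side is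
- <nabla_E (nabla_X E), X> - <nabla_{nabla_X E} E, X> + <nabla_{nabla_E X} E, X>.
By the Killing equation the second term is |nabla_X E|^2 and the third is
- <nabla_X E, nabla_E X>; the first and the third add up to - E <nabla_X E, X>,
the derivative of a function that vanishes identically. *)
Lemma killing_curv4 E X p : killing g D E -> D E E = 0 ->
  curv4 X E E X p = metric g (D X E p) (D X E p).
Proof.
move=> kE EE.
have skew0 q : inner g (D X E) X q = 0.
  by have := killing_skew X X q kE; rewrite /=; lra.
have := metric_compat E (D X E) X p; rewrite (tangent_cst _ skew0).
rewrite curv4E EE conn0r -(levi_civita_torsion_free lcD) connBl vfieldBE metricBl.
rewrite metric0l (killing_skew (D X E)) // (killing_skew (D E X)) //.
lra.
Qed.

End Curvature.

(** * Nonpositive curvature along E *)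

Theorem proposition2p2 (R : realType) (n : nat) (hn : (3 <= n)%N)
    (M : manifold R n) (g : riemannian_metric M)
    (nabla : vfield M -> vfield M -> vfield M) (hnabla : levi_civita g nabla)
    (E : vfield M) (hE : killing g nabla E)
    (c : R) (hc : 0 < c) (hlen : forall p : M, field_length g E p = c)
    (hK : forall (p : M) (s : set (tangent p)),
        tangent_plane s -> s (E p) -> sectional_curvature g nabla s <= 0) :
  (forall (p : M) (s : set (tangent p)),
      tangent_plane s -> s (E p) -> sectional_curvature g nabla s = 0) /\
  (forall X : vfield M, nabla X E = 0).
Proof.
have Ecc p : metric g (E p) (E p) = c ^+ 2.
  by rewrite -(hlen p) sqr_sqrtr // metric_ge0.
have Ep0 p : E p != 0.
  apply/eqP => Ep; have := Ecc p; rewrite Ep metric0l => /esym/eqP.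
  by rewrite sqrf_eq0 gt_eqF.
have parallel X : nabla X E = 0.
  apply: vfieldP => p; apply: (@metric_eq0 _ _ _ g).
  have [li|/existsNP[a /existsNP[b /not_implyP[ab0 nab]]]] :=
    pselect (lin_indep (X p) (E p)).
    apply/le_anti; rewrite metric_ge0 andbT.
    rewrite -(killing_curv4 hnabla _ _ hE (killing_geodesic hnabla hE Ecc)).
    have := hK p (span2 (X p) (E p)); rewrite (sectional_curvatureE hnabla) //.
    rewrite pmulr_lle0 ?invr_gt0 ?gram_gt0 //; apply.
    - by exists (X p), (E p).
    - by exists 0, 1; rewrite scale0r scale1r add0r.
  (* Now X p is a multiple of E p. *)
  have a0 : a != 0.
    apply/eqP => a0; apply: nab; split=> //; apply/eqP.
    move: ab0; rewrite a0 scale0r add0r => /eqP.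
    by rewrite scaler_eq0 (negPf (Ep0 p)) orbF.
  apply: (mulfI a0); rewrite mulr0 (killing_skew X (nabla X E) p hE).
  have /eqP := congr1 (metric g (nabla (nabla X E) E p)) ab0.
  rewrite metricDr !metricZr (const_length_orth hnabla _ _ Ecc) mulr0 addr0.
  rewrite (Defs.metric_sym g _ 0) metric0l mulrN => /eqP ->.
  by rewrite oppr0.
split=> // p s _ sE.
(* If no fields span s, the sectional curvature is the default value 0. *)
rewrite /sectional_curvature; case: xgetP => // k _ [X [Y [li sXY ->]]].
have [a [b Eab]] : span2 (X p) (Y p) (E p) by rewrite -sXY.
(* R(X,Y)E = 0, with E expanded in the basis (X, Y) of the plane. *)
have flat Z : a * curv4 g nabla X Y X Z p + b * curv4 g nabla X Y Y Z p = 0.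
  rewrite -(curv4_linear3 hnabla _ _ _ Eab) curv4E !parallel !(conn0r hnabla).
  by rewrite !metric0l !subr0.
rewrite -[LHS]/(curv4 g nabla X Y Y X p / gram g (X p) (Y p)).
suff -> : curv4 g nabla X Y Y X p = 0 by rewrite mul0r.
have := flat X; have := flat Y.
rewrite !(curv4_skew34_diag hnabla) !mulr0 addr0 add0r => /eqP + /eqP.
rewrite (curv4_skew34 hnabla X Y X Y) !mulf_eq0 oppr_eq0.
case/orP=> [/eqP a0|/eqP//]; case/orP=> [/eqP b0|/eqP//].
by have := Ep0 p; rewrite Eab a0 b0 !scale0r addr0 eqxx.
Qed.
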